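(* Let $E,A\in\mathbb{R}^{n\times n}$ and $B_i\in\mathbb{R}^{n\times m_i}$, $i\in\mathsf N=\{1,\dots,N\}$, be such that $(E,A)$ is regular of index $1$ and $(J,\bar B_{1i})$ is stabilizable for every $i\in\mathsf N$, and let $F\in\mathsf F_s$. Let $\operatorname{rank}(E)=r<n$. For $i\in\mathsf N$ let $\Gamma_i^1=\{\theta_i\in\mathbb{R}^L:\mathcal M_i\theta_i=0\}$, where $L=\tfrac12\big(n(n+1)+\sum_{j=1}^Nm_j(m_j+1)\big)$ and $\mathcal M_i\in\mathbb{R}^{rm_i\times L}$ is the matrix defined in the context. Then, for every $i\in\mathsf N$, $$\dim(\Gamma_i^1)\ \ge\ L-rm_i\ >\ L-nm_i\ >\ 0.$$
   Context: Notation. $\mathbb{C}^-$ is the open left half-plane; $\otimes$ is the Kronecker product; for a symmetric $k\times k$ matrix $S$, $\operatorname{vec}(S)$ is column-wise vectorization, $\operatorname{vech}(S)\in\mathbb{R}^{k(k+1)/2}$ stacks the lower-triangular entries column-wise, and $\mathcal D_k$ is the $k^2\times k(k+1)/2$ duplication matrix, $\operatorname{vec}(S)=\mathcal D_k\operatorname{vech}(S)$. $m=\sum_{i\in\mathsf N}m_i$; $B=[B_1\ \cdots\ B_N]\in\mathbb{R}^{n\times m}$. Setting. $N$ players control the descriptor system $E\dot x=Ax+\sum_{i\in\mathsf N}B_iu_i$ through linear feedback $u_i=F_ix$, $F_i\in\mathbb{R}^{m_i\times n}$; $F\in\mathbb{R}^{m\times n}$ stacks $F_1,\dots,F_N$ vertically.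 Player $i$ has cost $\int_0^\infty(x^\top Q_ix+\sum_{j\in\mathsf N}u_j^\top R_{ij}u_j)\,dt$ with symmetric $Q_i\in\mathbb{R}^{n\times n}$, $R_{ij}\in\mathbb{R}^{m_j\times m_j}$. Player $i$'s parameters are encoded as $\theta_i=[\operatorname{vech}(Q_i)^\top\ \operatorname{vech}(R_{i1})^\top\ \cdots\ \operatorname{vech}(R_{iN})^\top]^\top\in\mathbb{R}^L$. Regularity, index and canonical form. A pair $(E,A)$ is regular if $\det(\lambda E-A)\neq0$ for some $\lambda\in\mathbb{C}$. A regular pair has a Kronecker canonical form: there are nonsingular real $X,Y$ such that $Y^\top EX=\operatorname{diag}(I,\mathcal{N})$ and $Y^\top AX=\operatorname{diag}(J,I)$, with $\mathcal{N}$ a nilpotent Jordan matrix and $J$ the Jordan matrix associated with the finite eigenvalues of the pencil $\lambda E-A$. The index is the least $\mu$ with $\mathcal{N}^\mu=0$. When $(E,A)$ has index $1$, $\mathcal{N}=0$, $J\in\mathbb{R}^{r\times r}$ with $r=\operatorname{rank}(E)$, and $$Y^\top EX=\begin{bmatrix}I_r&0\\0&0\end{bmatrix},\qquad Y^\top AX=\begin{bmatrix}J&0\\0&I_{n-r}\end{bmatrix}.$$ Fix such $X,Y$ and partition $X=[X_1\ X_2]$ with $X_1\in\mathbb{R}^{n\times r}$, $X_2\in\mathbb{R}^{n\times(n-r)}$. Put $\bar B_{1i}=[I_r\ 0]Y^\top B_i$, $\bar B_{2i}=[0\ I_{n-r}]Y^\top B_i$, $\bar B_1=[\bar B_{11}\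 \cdots\ \bar B_{1N}]$, $\bar B_2=[\bar B_{21}\ \cdots\ \bar B_{2N}]$. Admissible profiles. $\mathsf F_s$ is the set of $F\in\mathbb{R}^{m\times n}$ such that $(E,A+BF)$ is regular, has index $1$, and all finite eigenvalues of $(E,A+BF)$ lie in $\mathbb{C}^-$. For $F\in\mathsf F_s$ put $\bar F=\Omega(F):=F(I_n+X_2\bar B_2F)^{-1}X_1\in\mathbb{R}^{m\times r}$, with block rows $\bar F_i\in\mathbb{R}^{m_i\times r}$, and $\bar A_{\mathrm{cl}}:=J+\bar B_1\bar F$. Matrices. Define $$\mathcal K:=(I_r\otimes \bar A_{\mathrm{cl}}^\top)+(\bar A_{\mathrm{cl}}^\top\otimes I_r),$$ $$\mathcal M_Q:=X_1^\top\otimes X_1^\top-\bar F^\top\bar B_2^\top X_2^\top\otimes X_1^\top-X_1^\top\otimes\bar F^\top\bar B_2^\top X_2^\top+\bar F^\top\bar B_2^\top X_2^\top\otimes\bar F^\top\bar B_2^\top X_2^\top,$$ $$\mathcal N_Q^i:=\bar F^\top\bar B_2^\top X_2^\top\otimes\bar B_{2i}^\top X_2^\top-X_1^\top\otimes\bar B_{2i}^\top X_2^\top,\qquad \mathcal M_Q^i:=\mathcal N_Q^i-(I_r\otimes\bar B_{1i}^\top)\mathcal K^{-1}\mathcal M_Q,$$ $\mathcal M_R^{ii}:=(\bar F_i^\top\otimes I_{m_i})-(I_r\otimes\bar B_{1i}^\top)\mathcal K^{-1}(\bar F_i^\top\otimes\bar F_i^\top)$, $\mathcal M_R^{ij}:=-(I_r\otimes\bar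 B_{1i}^\top)\mathcal K^{-1}(\bar F_j^\top\otimes\bar F_j^\top)$ for $i\neq j$, and $$\mathcal M_i:=\begin{bmatrix}\mathcal M_Q^i\mathcal D_n&\mathcal M_R^{i1}\mathcal D_{m_1}&\cdots&\mathcal M_R^{iN}\mathcal D_{m_N}\end{bmatrix}\in\mathbb{R}^{rm_i\times L}.$$ *)

(* Defs.v *)
From HB Require Import structures.
From mathcomp Require Import all_boot all_order all_algebra.
From mathcomp Require Import reals.
From mathcomp.real_closed Require Import complex mxtens.

Set Implicit Arguments.
Unset Strict Implicit.
Unset Printing Implicit Defensive.

Import Order.TTheory GRing.Theory Num.Theory.
Local Open Scope ring_scope.

(* The Kronecker product is [tensmx], written A *t B. *)

Section Vectorization.

Variable R : realType.

(* Column-wise: the entry S i j is at position j * k + i, which is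
   [mxtens_index (j, i)]; so vec matches the index convention of *t, see
   [vec_mul]. *)
Definition vec p q (S : 'M[R]_(p, q)) : 'cV[R]_(q * p) :=
  \col_a S (mxtens_unindex a).2 (mxtens_unindex a).1.

Lemma vec_mul p q u v (A : 'M[R]_(u, p)) (S : 'M[R]_(p, q)) (B : 'M[R]_(q, v)) :
  vec (A *m S *m B) = (B^T *t A) *m vec S.
Proof.
apply/colP => a; case: (mxtens_indexP a) => j i.
rewrite !mxE mxtens_indexK /=.
under eq_bigr => l _ do rewrite mxE mulr_suml.
rewrite pair_big /= (reindex (@mxtens_unindex q p)) /=; last first.
  by exists (@mxtens_index _ _) => ? _; rewrite ?mxtens_unindexK ?mxtens_indexK.
apply: eq_bigr => b _; rewrite !mxE mxtens_indexK /=.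
by rewrite mulrAC; congr (_ * _); rewrite mulrC.
Qed.

Definition vech_dim (k : nat) : nat := ((k * (k + 1))./2)%N.

(* The positions (row, column) of the lower triangle, column after column. *)
Definition vech_pairs (k : nat) : seq ('I_k * 'I_k) :=
  [seq ij : 'I_k * 'I_k <- [seq (i, j) | j <- enum 'I_k, i <- enum 'I_k] | (ij.2 <= ij.1)%N].

Lemma size_vech_pairs k : size (vech_pairs k) = vech_dim k.
Proof.
rewrite /vech_pairs size_filter -sum1_count big_mkcond big_allpairs_dep /=.
rewrite big_enum /=; under eq_bigr do rewrite big_enum /=.
rewrite exchange_big /vech_dim addn1 mulnC -[k in (_ * k)%N]/(k.+1.-1).
rewrite -bin2 -bin2_sum big_mkord [RHS]big_ord_recl add0n /=.
apply: eq_bigr => i _; rewrite -big_mkcond /bump /= add1n.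
rewrite -[RHS]card_ord -sum1_card; symmetry.
exact: (big_ord_widen k (fun=> 1%N) (ltn_ord i)).
Qed.

Definition vech k (S : 'M[R]_k) : 'cV[R]_(vech_dim k) :=
  \col_a nth 0 [seq S ij.1 ij.2 | ij <- vech_pairs k] a.

(* The row of S i j has its only 1 in the column of the lower-triangular
   position among (i, j) and (j, i). *)
Definition dup_mx k : 'M[R]_(k * k, vech_dim k) :=
  \matrix_(a, b)
    let: (j, i) := mxtens_unindex a in
    ((b : nat) == index (if (j <= i)%N then (i, j) else (j, i)) (vech_pairs k))%:R.

(* The defining property of the duplication matrix. *)
Lemma dup_mxP k (S : 'M[R]_k) : S^T = S -> vec S = dup_mx k *m vech S.
Proof.
move=> symS; apply/colP => a; case: (mxtens_indexP a) => j i.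
rewrite !mxE mxtens_indexK /=.
pose p := if (j <= i)%N then (i, j) else (j, i).
have pin : p \in vech_pairs k.
  rewrite mem_filter; apply/andP; split.
    rewrite /p; case: ifP => [//|/negbT]; rewrite -ltnNge; exact: ltnW.
  by rewrite /p; case: ifP => _; apply/allpairsP;
    [exists (j, i)|exists (i, j)]; rewrite /= !mem_enum.
have lt_p : (index p (vech_pairs k) < vech_dim k)%N.
  by rewrite -size_vech_pairs index_mem.
rewrite (bigD1 (Ordinal lt_p)) //= big1 => [|b nb].
  rewrite !mxE mxtens_indexK /= -/p eqxx mul1r addr0.
  rewrite (nth_map p) ?index_mem // nth_index // /p; case: ifP => //= _.
  by rewrite -[in LHS]symS mxE.
rewrite !mxE mxtens_indexK /= -/p.
by rewrite (negPf (_ : (b : nat) != index p _)) ?mul0r.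
Qed.

End Vectorization.

Section MatrixPencils.

Variable R : realType.

Definition cmx p q (M : 'M[R]_(p, q)) : 'M[R[i]]_(p, q) :=
  map_mx (@real_complex R) M.

Definition regular n (E A : 'M[R]_n) : Prop :=
  exists lambda : R[i], \det (lambda *: cmx E - cmx A) != 0.

Definition finite_eigenvalue n (E A : 'M[R]_n) (lambda : R[i]) : Prop :=
  \det (lambda *: cmx E - cmx A) = 0.

Definition shift_mx k : 'M[R]_k := \matrix_(i, j) ((j : nat) == i.+1)%:R.

Definition jordan_block k (a : R) : 'M[R]_k := a%:M + shift_mx k.

Definition rotation_mx (a b : R) : 'M[R]_2 :=
  \matrix_(i, j) (if i == j then a else if (i < j)%N then b else - b).

(* Real Jordan block of the conjugate pair a +/- b i. *)
Definition conj_jordan_block k (a b : R) : 'M[R]_(k * 2) :=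
  1%:M *t rotation_mx a b + shift_mx k *t 1%:M.

(* Since the transformations X, Y are real, "Jordan matrix" means real Jordan
   matrix: non-real eigenvalues contribute real blocks. *)
Inductive jordan_mx : forall n, 'M[R]_n -> Prop :=
| JordanNil : jordan_mx (0 : 'M[R]_0)
| JordanReal k a n (J : 'M[R]_n) :
    jordan_mx J -> jordan_mx (block_mx (jordan_block k.+1 a) 0 0 J)
| JordanConj k a b n (J : 'M[R]_n) : b != 0 ->
    jordan_mx J -> jordan_mx (block_mx (conj_jordan_block k.+1 a b) 0 0 J).

Definition kronecker_form n r s (def_n : (r + s)%N = n)
    (E A X Y : 'M[R]_n) (J : 'M[R]_r) (N : 'M[R]_s) : Prop :=
  [/\ X \in unitmx /\ Y \in unitmx,
      Y^T *m E *m X = castmx (def_n, def_n) (block_mx 1%:M 0 0 N),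
      Y^T *m A *m X = castmx (def_n, def_n) (block_mx J 0 0 1%:M),
      jordan_mx J
    & jordan_mx N /\ exists k, N ^+ k = 0].

Definition has_index n (E A : 'M[R]_n) (mu : nat) : Prop :=
  exists r s (def_n : (r + s)%N = n) X Y (J : 'M[R]_r) (N : 'M[R]_s),
    [/\ kronecker_form def_n E A X Y J N,
        N ^+ mu = 0
      & forall k, N ^+ k = 0 -> (mu <= k)%N].

Definition stabilizable n p (A : 'M[R]_n) (B : 'M[R]_(n, p)) : Prop :=
  exists K : 'M[R]_(p, n),
    forall lambda : R[i],
      eigenvalue (cmx (A + B *m K)) lambda -> complex.Re lambda < 0.

(* F \in F_s *)
Definition admissible n p (E A : 'M[R]_n) (B : 'M[R]_(n, p))
    (F : 'M[R]_(p, n)) : Prop :=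
  [/\ regular E (A + B *m F),
      has_index E (A + B *m F) 1
    & forall lambda : R[i],
        finite_eigenvalue E (A + B *m F) lambda -> complex.Re lambda < 0].

End MatrixPencils.

Section Game.

(* n = r + s, X = [X1 X2] with X1 of width r, and s = n - r. *)
Variables (R : realType) (N r s : nat) (m : 'I_N -> nat).
Variables (X Y : 'M[R]_(r + s)) (J : 'M[R]_r).
Variable B : forall i, 'M[R]_(r + s, m i).
Variable F : 'M[R]_(\sum_i m i, r + s).

Definition X1 : 'M[R]_(r + s, r) := lsubmx X.
Definition X2 : 'M[R]_(r + s, s) := rsubmx X.

Definition B1i i : 'M[R]_(r, m i) := row_mx 1%:M 0 *m Y^T *m B i.
Definition B2i i : 'M[R]_(s, m i) := row_mx 0 1%:M *m Y^T *m B i.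
Definition B1 : 'M[R]_(r, \sum_i m i) := \mxrow_i B1i i.
Definition B2 : 'M[R]_(s, \sum_i m i) := \mxrow_i B2i i.

(* Omega(F) *)
Definition Fbar : 'M[R]_(\sum_i m i, r) :=
  F *m invmx (1%:M + X2 *m B2 *m F) *m X1.
Definition Fbari i : 'M[R]_(m i, r) := submxcol Fbar i.

Definition Acl : 'M[R]_r := J + B1 *m Fbar.

Definition KK : 'M[R]_(r * r) := 1%:M *t Acl^T + Acl^T *t 1%:M.

Definition MQ : 'M[R]_(r * r, (r + s) * (r + s)) :=
  X1^T *t X1^T
  - (Fbar^T *m B2^T *m X2^T) *t X1^T
  - X1^T *t (Fbar^T *m B2^T *m X2^T)
  + (Fbar^T *m B2^T *m X2^T) *t (Fbar^T *m B2^T *m X2^T).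

Definition NQi i : 'M[R]_(r * m i, (r + s) * (r + s)) :=
  (Fbar^T *m B2^T *m X2^T) *t ((B2i i)^T *m X2^T)
  - X1^T *t ((B2i i)^T *m X2^T).

Definition MQi i : 'M[R]_(r * m i, (r + s) * (r + s)) :=
  NQi i - (1%:M *t (B1i i)^T) *m invmx KK *m MQ.

Definition MRii i : 'M[R]_(r * m i, m i * m i) :=
  (Fbari i)^T *t 1%:M
  - (1%:M *t (B1i i)^T) *m invmx KK *m ((Fbari i)^T *t (Fbari i)^T).

Definition MRij i j : 'M[R]_(r * m i, m j * m j) :=
  - ((1%:M *t (B1i i)^T) *m invmx KK *m ((Fbari j)^T *t (Fbari j)^T)).

(* MR i i = MRii i, and MR i j = MRij i j for j != i; a dependent update is
   needed because the width of the block depends on j. *)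
Definition MR i : forall j, 'M[R]_(r * m i, m j * m j) :=
  dfwith (MRij i) (MRii i).

Lemma MR_eq i : MR i i = MRii i.
Proof. exact: dfwith_in. Qed.

Lemma MR_neq i j : i != j -> MR i j = MRij i j.
Proof. move=> ij; exact: dfwith_out. Qed.

(* The dimension L of the parameter space. *)
Definition theta_dim : nat :=
  (vech_dim (r + s) + \sum_j vech_dim (m j))%N.

Lemma theta_dimE :
  theta_dim%:R =
  ((r + s) * ((r + s) + 1) + \sum_j m j * (m j + 1))%N%:R / 2 :> rat.
Proof.
have vdE k : (k * (k + 1) = (vech_dim k).*2)%N.
  by rewrite /vech_dim even_halfK // oddM oddD addbT andbN.
rewrite vdE; under eq_bigr do rewrite vdE -muln2.
by rewrite -big_distrl /= -muln2 -mulnDl natrM mulfK.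
Qed.

Definition theta (Q : 'M[R]_(r + s)) (Ri : forall j, 'M[R]_(m j)) :
    'cV[R]_theta_dim :=
  col_mx (vech Q) (\mxcol_j vech (Ri j)).

Definition MM i : 'M[R]_(r * m i, theta_dim) :=
  row_mx (MQi i *m dup_mx R (r + s)) (\mxrow_j (MR i j *m dup_mx R (m j))).

Lemma MM_theta i (Q : 'M[R]_(r + s)) (Ri : forall j, 'M[R]_(m j)) :
  Q^T = Q -> (forall j, (Ri j)^T = Ri j) ->
  MM i *m theta Q Ri =
  MQi i *m vec Q + \sum_j MR i j *m vec (Ri j).
Proof.
move=> symQ symR; rewrite /MM /theta mul_row_col mul_mxrow_mxcol -mulmxA.
rewrite -dup_mxP //; congr (_ + _).
by apply: eq_bigr => j _; rewrite -mulmxA -dup_mxP.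
Qed.

(* {theta | MM i *m theta = 0}, see [mem_Gamma1]. *)
Definition Gamma1 i : {vspace 'cV[R]_theta_dim} := lker (linfun (mulmx (MM i))).

Lemma mem_Gamma1 i (th : 'cV[R]_theta_dim) :
  (th \in Gamma1 i) = (MM i *m th == 0).
Proof. by rewrite memv_ker lfunE. Qed.

End Game.

(* Main.v *)
Require Import Defs.
From mathcomp Require Import all_boot all_order all_algebra.
From mathcomp Require Import reals.
From mathcomp Require Import zify.
From mathcomp.real_closed Require Import complex mxtens.

Set Implicit Arguments.
Unset Strict Implicit.
Unset Printing Implicit Defensive.

Import Order.TTheory GRing.Theory Num.Theory.
Local Open Scope ring_scope.

(** [Gamma1] is the solution space of [r * m i] homogeneous linear equations in [L] unknowns, so
    rank-nullity bounds its dimension below. The middle inequality is strict because [r < n] and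
    [m i > 0]. Positivity follows from the share of [L] due to [Q_i] and [R_ii] alone, by
    [2ab <= a^2 + b^2]. *)

Lemma dim_lker_mulmx (K : fieldType) p q c (M : 'M[K]_(p, q)) :
  (q * c - p * c <= \dim (lker (linfun (mulmx M : 'M_(q, c) -> _))))%N.
Proof.
set f := linfun _; have := limg_ker_dim f fullv.
rewrite capfv dimvf => /esym dimE.
(* The rank is at most the dimension of the codomain. *)
have : (\dim (f @: fullv) <= p * c)%N.
  exact: leq_trans (dimvS (subvf _)) (eq_leq (dimvf _)).
move: dimE; rewrite [X in X = _]/dim /= => ->.
by rewrite leq_subLR addnC leq_add2r.
Qed.

Theorem mainTheorem3 (R : realType) (N r s : nat) (m : 'I_N -> nat)
    (E A X Y : 'M[R]_(r + s)) (J : 'M[R]_r)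
    (B : forall i, 'M[R]_(r + s, m i)) (F : 'M[R]_(\sum_i m i, r + s)) :
  let n := (r + s)%N in
  let L : rat := (n * (n + 1) + \sum_j m j * (m j + 1))%N%:R / 2 in
  (forall i, (0 < m i)%N) ->
  regular E A ->
  has_index E A 1 ->
  \rank E = r ->
  (r < n)%N ->
  kronecker_form erefl E A X Y J 0 ->
  (forall i, stabilizable J (B1i Y B i)) ->
  admissible E A (\mxrow_i B i) F ->
  forall i : 'I_N,
    [/\ L - (r * m i)%:R <= (\dim (Gamma1 X Y J B F i))%:R,
        L - (n * m i)%:R < L - (r * m i)%:R
      & 0 < L - (n * m i)%:R].
Proof.
move=> n L m_gt0 _ _ _ lt_rn _ _ _ i.
have LE : L = (theta_dim r s m)%:R by rewrite theta_dimE.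
split.
- rewrite LE lerBlDr -natrD ler_nat addnC -leq_subLR.
  by have := dim_lker_mulmx 1 (MM X Y J B F i); rewrite !muln1.
- by rewrite ltrD2l ltrN2 ltr_nat ltn_pmul2r.
(* Doubling clears the denominator of [L]; the summand [j = i] is isolated. *)
- rewrite subr_gt0 ltr_pdivlMr // -natrM ltr_nat (bigD1 i) //=.
  have [AGM _] := nat_Cauchy n (m i).
  have := m_gt0 i; rewrite -/n; clearbody n.
  (* With [S >= 0], [n^2 + (m i)^2 >= 2 n (m i)] leaves a surplus of at least [n + m i > 0], which
     makes the bound strict. *)
  set S := \sum_(j | _) _; nia.
Qed.
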